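(* Let $M$ be an $n$-dimensional free $\mathbb{T}$-module. The action of a bicomplex linear operator on $M$ can be represented by a bicomplex matrix; that is, for every bicomplex linear operator $A:M\to M$ and every basis $\{|m_l\rangle\}_{l=1}^n$ of $M$, there is an $n\times n$ matrix $(A_{pl})$ with entries in $\mathbb{T}$ such that for every $|\psi\rangle=\sum_{l=1}^n w_l|m_l\rangle$ with $w_l\in\mathbb{T}$, the components $w'_p$ of $A|\psi\rangle=\sum_{p=1}^n w'_p|m_p\rangle$ are $w'_p=\sum_{l=1}^n A_{pl}w_l$.
   Context: Bicomplex numbers: $\mathbb{T}$ is the commutative ring of elements $w=z_1+z_2\mathbf{i_2}$ with $z_1,z_2\in\mathbb{C}(\mathbf{i_1})=\{x+y\mathbf{i_1}: x,y\in\mathbb{R}\}$ (a copy of the complex field), where $\mathbf{i_1}^2=\mathbf{i_2}^2=-1$ and $\mathbf{i_1}\mathbf{i_2}=\mathbf{i_2}\mathbf{i_1}=\mathbf{j}$, so $\mathbf{j}^2=1$. An $n$-dimensional free $\mathbb{T}$-module is a $\mathbb{T}$-module with a basis (linearly independent generating set) of $n$ elements. A bicomplex linear operator is a $\mathbb{T}$-linear map $A:M\to M$. *)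

(* Defs.v *)
From HB Require Import structures.
From mathcomp Require Import all_boot all_order all_algebra.
From mathcomp Require Import complex.
From mathcomp Require Import reals.
From mathcomp Require Import ring.

Set Implicit Arguments.
Unset Strict Implicit.
Unset Printing Implicit Defensive.

Import GRing.Theory.
Local Open Scope ring_scope.

(* [Bicomplex z1 z2] is z1 + z2 i2. A dedicated record is used because the
   pair type already carries the componentwise product ring structure. *)
Record bicomplex (R : realType) : Type := Bicomplex {
  bc1 : complex R;
  bc2 : complex R
}.

Section BicomplexRing.
Variable R : realType.
Local Notation C := (complex R).
Local Notation T := (bicomplex R).
Implicit Types u v w : T.

Definition pair_of_bicomplex w : C * C := (bc1 w, bc2 w).
Definition bicomplex_of_pair (p : C * C) : T := Bicomplex p.1 p.2.

Lemma pair_of_bicomplexK : cancel pair_of_bicomplex bicomplex_of_pair.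
Proof. by case. Qed.

HB.instance Definition _ := Choice.copy T (can_type pair_of_bicomplexK).

Definition bc_zero : T := Bicomplex 0 0.
Definition bc_opp u : T := Bicomplex (- bc1 u) (- bc2 u).
Definition bc_add u v : T := Bicomplex (bc1 u + bc1 v) (bc2 u + bc2 v).

Lemma bc_addA : associative bc_add.
Proof. by case=> [a b] [c d] [e f]; rewrite /bc_add /= !addrA. Qed.

Lemma bc_addC : commutative bc_add.
Proof.
by case=> [a b] [c d]; rewrite /bc_add /= (addrC a) (addrC b).
Qed.

Lemma bc_add0 : left_id bc_zero bc_add.
Proof. by case=> [a b]; rewrite /bc_add /= !add0r. Qed.

Lemma bc_addN : left_inverse bc_zero bc_opp bc_add.
Proof. by case=> [a b]; rewrite /bc_add /= !addNr. Qed.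

HB.instance Definition _ :=
  GRing.isZmodule.Build T bc_addA bc_addC bc_add0 bc_addN.

Definition bc_one : T := Bicomplex 1 0.

(* (z1 + z2 i2) (z1' + z2' i2), expanded with i2 ^ 2 = -1 *)
Definition bc_mul u v : T :=
  Bicomplex (bc1 u * bc1 v - bc2 u * bc2 v) (bc1 u * bc2 v + bc2 u * bc1 v).

Lemma bc_mulA : associative bc_mul.
Proof.
by case=> [a b] [c d] [e f]; rewrite /bc_mul /=; congr Bicomplex; ring.
Qed.

Lemma bc_mulC : commutative bc_mul.
Proof. by case=> [a b] [c d]; rewrite /bc_mul /=; congr Bicomplex; ring. Qed.

Lemma bc_mul1 : left_id bc_one bc_mul.
Proof. by case=> [a b]; rewrite /bc_mul /=; congr Bicomplex; ring. Qed.

Lemma bc_mulDl : left_distributive bc_mul bc_add.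
Proof.
by case=> [a b] [c d] [e f]; rewrite /bc_mul /bc_add /=; congr Bicomplex; ring.
Qed.

Lemma bc_one_neq0 : bc_one != 0.
Proof. by apply/eqP => -[] /eqP; rewrite oner_eq0. Qed.

HB.instance Definition _ :=
  GRing.Zmodule_isComNzRing.Build T
    bc_mulA bc_mulC bc_mul1 bc_mulDl bc_one_neq0.

Definition bc_of_complex (z : C) : T := Bicomplex z 0.
Definition bc_i1 : T := bc_of_complex (Complex 0 1).
Definition bc_i2 : T := Bicomplex 0 1.
Definition bc_j : T := bc_i1 * bc_i2.

Lemma bicomplexE (z1 z2 : C) :
  Bicomplex z1 z2 = bc_of_complex z1 + bc_of_complex z2 * bc_i2.
Proof.
apply: (can_inj pair_of_bicomplexK).
by rewrite /pair_of_bicomplex /=; congr pair; ring.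
Qed.

Lemma bc_i1_sqr : bc_i1 ^+ 2 = -1.
Proof.
apply: (can_inj pair_of_bicomplexK); rewrite expr2 /pair_of_bicomplex /=.
by congr pair; [rewrite mulr0 subr0 -expr2 sqr_i | ring].
Qed.

Lemma bc_i2_sqr : bc_i2 ^+ 2 = -1.
Proof.
apply: (can_inj pair_of_bicomplexK).
by rewrite expr2 /pair_of_bicomplex /=; congr pair; ring.
Qed.

Lemma bc_j_sqr : bc_j ^+ 2 = 1.
Proof. by rewrite exprMn bc_i1_sqr bc_i2_sqr mulrNN mulr1. Qed.

End BicomplexRing.

Section FreeModule.
Variables (K : nzRingType) (M : lmodType K) (n : nat).
Implicit Type m : 'I_n -> M.

Definition lin_indep m : Prop :=
  forall c : 'I_n -> K, \sum_(l < n) c l *: m l = 0 -> forall l, c l = 0.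

Definition generating m : Prop :=
  forall v : M, exists c : 'I_n -> K, v = \sum_(l < n) c l *: m l.

Definition is_basis m : Prop := lin_indep m /\ generating m.

End FreeModule.

Definition free_of_dim (K : nzRingType) (M : lmodType K) (n : nat) : Prop :=
  exists m : 'I_n -> M, is_basis m.

(* Main.v *)
Require Import Defs.
From HB Require Import structures.
From mathcomp Require Import all_boot all_order all_algebra.
From mathcomp Require Import reals.

Import GRing.Theory.
Local Open Scope ring_scope.

(** Column [l] of the matrix holds coordinates of [A (m l)], which exist because [m] generates
    ([generating_matrix]). Linearity then gives an expansion of [A psi] with the required
    coefficients ([linear_sum_matrix]), and linear independence makes these the only possible ones
    ([lin_indep_inj]). *)

Lemma lin_indep_inj (K : nzRingType) (M : lmodType K) (n : nat)
    (m : 'I_n -> M) (c d : 'I_n -> K) :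
  lin_indep m ->
  \sum_(l < n) c l *: m l = \sum_(l < n) d l *: m l -> forall l, c l = d l.
Proof.
move=> indep_m eq_cd l; apply/subr0_eq.
apply: (indep_m (fun l => c l - d l)).
under eq_bigr do rewrite scalerBl.
by rewrite sumrB eq_cd subrr.
Qed.

(** Push [A] through the sum, expand each image, and exchange the two summations. Neither family has
    to be a basis. *)
Lemma linear_sum_matrix (K : comNzRingType) (M N : lmodType K) (n p : nat)
    (A : {linear M -> N}) (m : 'I_n -> M) (m' : 'I_p -> N)
    (B : 'M[K]_(p, n)) (w : 'I_n -> K) :
  (forall l, A (m l) = \sum_(k < p) B k l *: m' k) ->
  A (\sum_(l < n) w l *: m l)
    = \sum_(k < p) (\sum_(l < n) B k l * w l) *: m' k.
Proof.
move=> AB; rewrite linear_sum.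
under eq_bigr do rewrite linearZ /= AB scaler_sumr.
rewrite exchange_big; apply: eq_bigr => k _; rewrite scaler_suml.
(* Linearity produces [w l * B k l]; commutativity of [K] moves the matrix entry to the left. *)
by apply: eq_bigr => l _; rewrite scalerA mulrC.
Qed.

Lemma generating_matrix (K : nzRingType) (M : lmodType K) (n p : nat)
    (m : 'I_p -> M) (v : 'I_n -> M) :
  generating m ->
  exists B : 'M[K]_(p, n), forall l, v l = \sum_(k < p) B k l *: m k.
Proof.
move=> gen_m; have [b vb] := fin_all_exists (fun l => gen_m (v l)).
(* The indices are swapped so that the coordinates [b l] of [v l] form a column. *)
exists (\matrix_(k, l) b l k) => l; rewrite vb.
by apply: eq_bigr => k _; rewrite mxE.
Qed.

Theorem theorem3p12 (R : realType) (n : nat) (M : lmodType (bicomplex R))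
    (hM : free_of_dim M n)
    (A : {linear M -> M}) (m : 'I_n -> M) (hm : is_basis m) :
  exists Amx : 'M[bicomplex R]_n,
    forall (psi : M) (w : 'I_n -> bicomplex R),
      psi = \sum_(l < n) w l *: m l ->
      forall w' : 'I_n -> bicomplex R,
        A psi = \sum_(p < n) w' p *: m p <->
        (forall p : 'I_n, w' p = \sum_(l < n) Amx p l * w l).
Proof.
case: hm => indep_m gen_m.
have [Amx AmxE] := generating_matrix _ _ _ _ _ (fun l => A (m l)) gen_m.
exists Amx => psi w -> w'.
rewrite (linear_sum_matrix _ _ _ _ _ _ _ _ _ _ AmxE).
split=> [eq_w' p | w'E].
  (* Only this direction uses independence: two expansions of [A psi] are compared. *)
  by rewrite -(lin_indep_inj _ _ _ _ _ _ indep_m eq_w' p).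
by apply: eq_bigr => p _; rewrite w'E.
Qed.
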